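(* Let $m,n\ge1$ be integers and let $\alpha\in\mathbb{F}_q$. The number of monic $n$-smooth polynomials over $\mathbb{F}_q$ of the form $x^m+\alpha x^{m-1}+g(x)$, where $g\in\mathbb{F}_q[x]$ has degree at most $m-2$, is $$q^{m-1}\sum_{(j_{n+1},\dots,j_m)}\mathbf{1}\Big[\sum_{i=n+1}^m ij_i\le m\Big]\prod_{i=n+1}^m q^{-ij_i}\binom{|I_i|}{j_i}(-1)^{j_i}$$ $$\qquad+\frac{v(\alpha)}{q}\sum_{(k_{n+1},\dots,k_m)}\mathbf{1}\Big[\sum_{i=n+1}^m ik_i=m\Big]\prod_{i=n+1}^m A_{k_i}(a_i,b_i)(-1)^{k_i},$$ where the first sum runs over tuples of integers $0\le j_i\le|I_i|$, the second over tuples of integers $k_i\ge0$, and $v(\alpha)=q\,\mathbf{1}[\alpha=0]-1$.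
   Context: $\mathbb{F}_q$ is a finite field with $q=p^e$ elements, $p$ prime, $e\ge1$, and $I_i$ is the set of monic irreducible polynomials of degree $i$ over $\mathbb{F}_q$. A polynomial is $n$-smooth if all its irreducible factors have degree at most $n$. For $i\ge1$ put $$a_i=\frac{1}{iq}\sum_{k\mid i,\;p\nmid k}\mu(k)q^{i/k},\qquad b_i=\frac1i\sum_{k\mid i,\;p\mid k}\mu(k)q^{i/k},$$ with $\mu$ the Möbius function; these are integers ($b_i$ may be negative). For integers $k\ge 0$, $a,b$, put $$A_k(a,b)=\sum_{j=0}^{\lfloor k/p\rfloor}\binom{aq/p}{j}\binom{b}{k-pj}(-1)^{j+pj}\quad(b\ne0),\qquad A_k(a,0)=\binom{aq/p}{k/p}(-1)^{k+k/p}\,\mathbf{1}[p\mid k].$$ Binomial coefficients are generalized: $\binom{x}{n}=x(x-1)\cdots(x-n+1)/n!$ for integers $n\ge0$. $\mathbf{1}[P]$ is $1$ if $P$ is true and $0$ otherwise (and $A_k(a,0)=0$ when $p\nmid k$). The zero polynomial is allowed for $g$; empty products are $1$ and empty sums are $0$. *)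

(* Defs.v *)
From HB Require Import structures.
From mathcomp Require Import all_boot all_order all_algebra.
From mathcomp Require Import boolp.

Set Implicit Arguments.
Unset Strict Implicit.
Unset Printing Implicit Defensive.

Import Order.TTheory GRing.Theory Num.Theory.
Local Open Scope ring_scope.

(* Meaningful for [n > 0] only; [primes n] has no repetition, so the test
   says that [n] is squarefree. *)
Definition mobius (n : nat) : int :=
  if all (fun r => logn r n == 1%N) (primes n) then (-1) ^+ size (primes n)
  else 0.

Definition gbinom (x : rat) (n : nat) : rat :=
  (\prod_(i < n) (x - i%:R)) / n`!%:R.

(* [{poly_i.+1 F}] is the finite type of polynomials of degree at most [i], and
   [irreducibleb] is the library's decision procedure for
   [irreducible_poly]. *)
Definition monic_irr (F : finFieldType) (i : nat) : {set {poly_i.+1 F}} :=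
  [set f : {poly_i.+1 F} |
     [&& (f : {poly F}) \is monic, size f == i.+1 & irreducibleb f]].

Definition smooth (F : fieldType) (n : nat) (f : {poly F}) : Prop :=
  forall d : {poly F}, irreducible_poly d -> (d %| f)%R -> ((size d).-1 <= n)%N.

(* The values of [acoef] and [bcoef] are integers, but this is not obvious from
   the formulas: they are kept as rationals, and [Acoef] accordingly takes
   rational [a] and [b]. *)
Definition acoef (p q i : nat) : rat :=
  (\sum_(k <- divisors i | ~~ (p %| k)%N)
     (mobius k)%:~R * (q ^ (i %/ k))%:R) / (i * q)%:R.

Definition bcoef (p q i : nat) : rat :=
  (\sum_(k <- divisors i | (p %| k)%N)
     (mobius k)%:~R * (q ^ (i %/ k))%:R) / i%:R.

Definition Acoef (p q k : nat) (a b : rat) : rat :=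
  if b == 0 then
    if (p %| k)%N
    then gbinom (a * q%:R / p%:R) (k %/ p) * (-1) ^+ (k + k %/ p)
    else 0
  else
    \sum_(j < (k %/ p).+1)
      gbinom (a * q%:R / p%:R) j * gbinom b (k - p * j) * (-1) ^+ (j + p * j).

(* The polynomial [g] ranges over [{poly_(m.-1) F}], i.e. has degree at most
   [m - 2] or is zero; for [m = 1] only [g = 0] remains. *)
Definition smooth_prescribed (F : finFieldType) (m n : nat) (alpha : F) :
    {set {poly_m.+1 F}} :=
  [set f : {poly_m.+1 F} |
     [&& (f : {poly F}) \is monic, `[< smooth n (f : {poly F}) >]
       & [exists g : {poly_(m.-1) F},
            (f : {poly F}) == 'X^m + alpha *: 'X^(m.-1) + (g : {poly F})]]].

(* Main.v *)
(* Write c(f) for the coefficient of x^(deg f - 1) in a monic f. For a nontrivial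
   additive character chi of F_q the weight chi(c(f)) is multiplicative, and it
   sums to 0 over the monic polynomials of any positive degree, so its
   L-function is 1. Sieving by the irreducibles of degree > n, the weighted count
   of n-smooth polynomials of degree m is then the coefficient of u^m in
   prod_{deg P > n} (1 - chi(c(P)) u^(deg P)); with the trivial character
   1 / (1 - q u) appears as an extra factor, which gives the first sum.
   Von Mangoldt's identity and Moebius inversion show that a_i irreducibles of
   degree i have c(P) = c for each c <> 0, and a_i + b_i have c(P) = 0. Since
   prod_c (1 - chi(c) T) = (1 - T^p)^(q/p), the degree i part of the product is
   (1 - T)^b_i (1 - T^p)^(a_i q/p) with T = u^i, whose coefficients are
   (-1)^k A_k(a_i, b_i) even when b_i < 0. Orthogonality over the characters
   x |-> chi(t x) then isolates c(f) = alpha. *)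

Require Import Defs.
From HB Require Import structures.
From mathcomp Require Import all_boot all_order all_algebra.
From mathcomp Require Import all_fingroup all_field all_character.
From mathcomp Require Import boolp ring zify.

Set Implicit Arguments.
Unset Strict Implicit.
Unset Printing Implicit Defensive.

Import Order.TTheory GRing.Theory Num.Theory.
Local Open Scope ring_scope.

(** * Monic polynomials and their subleading coefficient *)

Section MonicPolynomials.

Variable F : finFieldType.
Implicit Types f g P Q : {poly F}.

(** A sequence of polynomials, not a set in a bounded type, so that monics of different degrees
    share one type and can be multiplied. *)
Definition monics (d : nat) : seq {poly F} :=
  map (fun g : {poly_d F} => 'X^d + (g : {poly F})) (enum {poly_d F}).

Definition irreds (d : nat) : seq {poly F} :=
  [seq P <- monics d | irreducibleb P].

(* The factor ['X] makes the subleading coefficient of [1] equal to [0]. *)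
Definition sublead (f : {poly F}) : F := ('X * f)`_(size f).-1.

Lemma monicsP d f :
  reflect (exists2 r : {poly F}, (size r <= d)%N & f = 'X^d + r) (f \in monics d).
Proof.
apply: (iffP mapP) => [[g _ ->]|[r sr ->]]; first by exists g; rewrite ?size_npoly.
by exists (npolyp d r); rewrite ?mem_enum //= npolypK.
Qed.

Lemma mem_monics d f : (f \in monics d) = (f \is monic) && (size f == d.+1).
Proof.
apply/monicsP/andP => [[r sr ->]|[/monicP lf /eqP sf]].
  have s : size ('X^d + r) = d.+1 by rewrite size_polyDl size_polyXn // ltnS.
  by rewrite s monicE lead_coefDl ?size_polyXn ?ltnS // lead_coefXn.
exists (f - 'X^d); last by rewrite addrC subrK.
apply/leq_sizeP => j; rewrite leq_eqVlt coefB coefXn => /predU1P[<-|lj].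
  by rewrite eqxx -lf lead_coefE sf subrr.
by rewrite nth_default ?sf // eq_sym ltn_eqF // subrr.
Qed.

Lemma monics_uniq d : uniq (monics d).
Proof.
by rewrite map_inj_uniq ?enum_uniq // => g h /addrI /val_inj.
Qed.

Lemma size_monics d : size (monics d) = (#|F| ^ d)%N.
Proof. by rewrite size_map -cardE card_npoly. Qed.

Lemma monics0 : monics 0 = [:: 1].
Proof.
apply/perm_small_eq => //; apply: uniq_perm; rewrite ?monics_uniq // => f.
rewrite mem_seq1; apply/monicsP/eqP => [[r]|->].
  by rewrite leqn0 size_poly_eq0 => /eqP-> ->; rewrite addr0.
by exists 0; rewrite ?size_poly0 // addr0.
Qed.

Lemma monicsM a b f g : f \in monics a -> g \in monics b -> f * g \in monics (a + b).
Proof.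
rewrite !mem_monics => /andP[mf /eqP sf] /andP[mg /eqP sg].
by rewrite monicMl // mg size_Mmonic ?monic_neq0 // sf sg addSn addnS /=.
Qed.

Lemma monicsX a k f : f \in monics a -> f ^+ k \in monics (a * k).
Proof.
move=> mf; elim: k => [|k IH]; first by rewrite muln0 monics0 mem_seq1.
by rewrite exprS mulnS monicsM.
Qed.

Lemma mem_irreds d P : (P \in irreds d) = irreducibleb P && (P \in monics d).
Proof. by rewrite mem_filter. Qed.

Lemma irreds_uniq d : uniq (irreds d).
Proof. by rewrite filter_uniq ?monics_uniq. Qed.

Lemma irreds_gt0 d P : P \in irreds d -> (0 < d)%N.
Proof.
rewrite mem_irreds mem_monics => /and3P[/irreducibleP [sP _] _ /eqP sP'].
by move: sP; rewrite sP'.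
Qed.

Lemma size_irreds d : size (irreds d) = #|monic_irr F d|.
Proof.
have -> : #|monic_irr F d| = size
    (map (fun f : {poly_d.+1 F} => (f : {poly F})) (enum (monic_irr F d))).
  by rewrite size_map -cardE.
apply/perm_size/uniq_perm; first exact: irreds_uniq.
  by rewrite map_inj_uniq ?enum_uniq //; exact: val_inj.
move=> f; apply/idP/mapP => [|[g]].
  rewrite mem_irreds mem_monics => /and3P[irf mf /eqP sf].
  exists (npolyp d.+1 f); last by rewrite npolypK ?sf.
  by rewrite mem_enum inE npolypK ?sf // mf irf eqxx.
by rewrite mem_enum inE => /and3P[mg sg ig] ->; rewrite mem_irreds mem_monics mg sg ig.
Qed.

Lemma monics_subleadE d f :
  f \in monics d -> sublead f = ('X * (f - 'X^d))`_d.
Proof.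
rewrite mem_monics /sublead => /andP[_ /eqP->] /=.
by rewrite mulrBr -exprS coefB coefXn ltn_eqF // subr0.
Qed.

Lemma subleadM a b f g :
  f \in monics a -> g \in monics b -> sublead (f * g) = sublead f + sublead g.
Proof.
move=> mf mg.
rewrite (monics_subleadE (monicsM mf mg)) (monics_subleadE mf) (monics_subleadE mg).
have /monicsP[r sr ->] := mf; have /monicsP[s ss ->] := mg.
rewrite !(addrAC _ _ (- _)) !subrr !add0r.
have -> : 'X * (('X^a + r) * ('X^b + s) - 'X^(a + b)) =
   'X * r * 'X^b + 'X * s * 'X^a + 'X * r * s by rewrite exprD; ring.
rewrite !coefD !coefMXn !ltnNge leq_addl leq_addr /= addnK addKn.
(* ['X * r * s] has size at most [a + b], so it misses the coefficient of index [a + b]. *)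
rewrite [X in _ + X]nth_default ?addr0 //.
apply: leq_trans (size_polyMleq _ _) _.
have := size_polyMleq 'X r; rewrite size_polyX => ?; lia.
Qed.

Lemma sublead1 : sublead 1 = 0.
Proof. by rewrite /sublead size_poly1 mulr1 coefX. Qed.

Lemma subleadX a k f : f \in monics a -> sublead (f ^+ k) = sublead f *+ k.
Proof.
move=> mf; elim: k => [|k IH]; first by rewrite sublead1.
by rewrite exprS (subleadM mf (monicsX k mf)) IH mulrS.
Qed.

Lemma perm_monics_dvdp a d P :
  P \in monics a -> (a <= d)%N ->
  perm_eq [seq f <- monics d | P %| f] [seq P * g | g <- monics (d - a)].
Proof.
move=> mP lead; apply: uniq_perm; first by rewrite filter_uniq ?monics_uniq.
  rewrite map_inj_in_uniq ?monics_uniq // => g h _ _.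
  by apply: mulfI; move: mP; rewrite mem_monics => /andP[/monic_neq0].
move=> f; rewrite mem_filter; apply/andP/mapP => [[/dvdpP[g ->]]|[g mg ->]].
  rewrite mulrC => mPg; exists g => //; move: mP mPg.
  rewrite !mem_monics => /andP[mP /eqP sP] /andP[mPg /eqP sPg].
  have mg : g \is monic by move: mPg; rewrite monicMl.
  rewrite mg /=; move: sPg; rewrite size_monicM ?monic_neq0 // sP => spg.
  by rewrite -subSn // -spg addSn addKn.
by rewrite dvdp_mulr // -(subnKC lead) monicsM.
Qed.

Lemma monics_Ndvdp a d P f :
  P \in monics a -> (d < a)%N -> f \in monics d -> (P %| f) = false.
Proof.
rewrite !mem_monics => /andP[_ /eqP sP] lda /andP[mf /eqP sf].
by apply/negP => /(dvdp_leq (monic_neq0 mf)); rewrite sP sf ltnS leqNgt lda.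
Qed.

(** The condition [C] serves the sieve, where divisibility by one irreducible is combined with
    conditions on the others. *)
Lemma big_monics_dvdp (R : nmodType) a d P (C : pred {poly F}) (phi : {poly F} -> R) :
  P \in monics a ->
  \sum_(f <- monics d | (P %| f) && C f) phi f =
  if (a <= d)%N then \sum_(g <- monics (d - a) | C (P * g)) phi (P * g) else 0.
Proof.
move=> mP; case: leqP => [lead|lda].
  by rewrite -big_filter_cond (perm_big _ (perm_monics_dvdp mP lead)) big_map.
rewrite big_seq_cond big_pred0 //= => f; apply/negP => /and3P[mf].
by rewrite (monics_Ndvdp mP lda mf).
Qed.

(** Descent on the degree: a reducible [f] has a nonconstant divisor of smaller size, which is made
    monic. *)
Lemma monics_irredP d f :
  f \in monics d -> (0 < d)%N ->
  exists c Q, [/\ Q \in irreds c, (c <= d)%N & Q %| f].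
Proof.
move=> mf d0.
have [n le_n] := ubnP d; elim: n => // n IH in d f mf d0 le_n *.
have sf : size f = d.+1 by move: mf; rewrite mem_monics => /andP[_ /eqP].
have f0 : f != 0 by rewrite -size_poly_eq0 sf.
have [irf|nirf] := boolP (irreducibleb f).
  by exists d, f; rewrite mem_irreds irf mf.
have [g [sg1 gf gNf]] : exists g, [/\ size g != 1, g %| f & ~ g %= f].
  apply: contrapT => H; move/negP: nirf; apply; apply/irreducibleP; split.
    by rewrite sf.
  by move=> g sg gf; apply: contrapT => gNf; apply: H; exists g.
have g0 : g != 0 by apply: contraNneq f0 => g0; move: gf; rewrite g0 dvd0p.
have lg0 : lead_coef g != 0 by rewrite lead_coef_eq0.
have sgf : (size g < size f)%N.
  rewrite ltn_neqAle dvdp_leq // andbT; apply/eqP => s; apply: gNf.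
  by rewrite -dvdp_size_eqp // s.
have mg : (lead_coef g)^-1 *: g \in monics (size g).-1.
  rewrite mem_monics monicE lead_coefZ mulVf // eqxx size_scale ?invr_eq0 //=.
  by rewrite prednK ?size_poly_gt0.
have sg0 : (0 < size g)%N by rewrite size_poly_gt0.
case: (IH _ _ mg) => [||c [Q [irQ lec Qg]]]; [lia|lia|].
exists c, Q; split=> //; first lia.
apply: dvdp_trans gf; by rewrite dvdpZr // invr_eq0 in Qg.
Qed.

Lemma irreds_coprimep a b P Q :
  P \in irreds a -> Q \in irreds b -> P != Q -> coprimep P Q.
Proof.
rewrite !mem_irreds !mem_monics.
move=> /and3P[/irreducibleP[_ irP] mP _] /and3P[/irreducibleP[sQ irQ] mQ _] PQ.
apply/negPn/negP; rewrite coprimep_def => ng.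
have gP := irP _ ng (dvdp_gcdl _ _); have gQ := irQ _ ng (dvdp_gcdr _ _).
have : P %= Q by rewrite -(eqp_ltrans gP).
by rewrite eqp_monic // (negPf PQ).
Qed.

(* Peeling off one irreducible factor of [f] at a time, so that unique
   factorization is not needed. *)
Lemma sum_irred_powers N n f :
  f \in monics n -> (n <= N)%N ->
  (\sum_(1 <= i < N.+1) \sum_(P <- irreds i) \sum_(1 <= k < N.+1)
     i * (P ^+ k %| f)%R = n)%N.
Proof.
elim/ltn_ind: n f => n IH f mf leN.
have [n0|n_gt0] := posnP n.
  move: mf; rewrite n0 monics0 mem_seq1 => /eqP->.
  rewrite big1_seq // => i _; rewrite big1_seq // => P /= irP.
  rewrite big1_seq // => k /=; rewrite mem_index_iota => /andP[k0 _].
  have i0 := irreds_gt0 irP.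
  move: irP; rewrite mem_irreds => /andP[_ mP].
  have m1 : 1 \in monics 0 by rewrite monics0 mem_seq1.
  by rewrite (monics_Ndvdp (monicsX k mP) _ m1) ?muln0 // muln_gt0 i0.
have [c [Q [irQ lecn Qf]]] := monics_irredP mf n_gt0.
have c0 := irreds_gt0 irQ.
have mQ : Q \in monics c by move: irQ; rewrite mem_irreds => /andP[].
have [g mg defg] : exists2 g, g \in monics (n - c) & f = Q * g.
  have : f \in [seq f <- monics n | Q %| f] by rewrite mem_filter Qf.
  by rewrite (perm_mem (perm_monics_dvdp mQ lecn)) => /mapP[g]; exists g.
have Q0 : Q != 0 by move: mQ; rewrite mem_monics => /andP[/monic_neq0].
(* Passing from [g] to [f = Q * g] adds one power of [Q] and changes nothing for the other
   irreducibles. *)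
have step i P : P \in irreds i ->
    (\sum_(1 <= k < N.+1) i * (P ^+ k %| f)%R =
     i * (P == Q)%R + \sum_(1 <= k < N.+1) i * (P ^+ k %| g)%R)%N.
  move=> irP; have [->|PQ] := eqVneq P Q; last first.
    rewrite muln0 add0n; apply: eq_bigr => k _; rewrite defg mulrC.
    by rewrite Gauss_dvdpl // coprimep_expl // (irreds_coprimep irP irQ).
  have N0 : (0 < N)%N by apply: leq_trans leN.
  rewrite big_nat_recl // expr1 Qf; congr (_ + _)%N.
  (* After the shift of [k] by one, the leftover term [k = N] vanishes: [Q ^+ N] has degree [c * N],
     which exceeds [n - c]. *)
  rewrite [in RHS]big_nat_recr //= (monics_Ndvdp (monicsX N mQ) _ mg) ?muln0 ?addn0.
    by apply: eq_bigr => k _; rewrite defg exprS dvdp_mul2l.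
  nia.
under eq_bigr => i _ do rewrite (eq_big_seq _ (@step i)) big_split /=.
rewrite big_split /= (IH (n - c)%N _ g) //; [|lia|lia].
rewrite (bigD1_seq c) ?iota_uniq ?mem_index_iota //=; [|lia].
rewrite (bigD1_seq Q) ?irreds_uniq //= eqxx muln1 big1 => [|P /negPf->]; last by rewrite muln0.
rewrite big1 ?addn0 => [|i ic]; first lia.
rewrite big1_seq // => P /= irP; case: eqP => [PQ|]; last by rewrite muln0.
move: irP ic; rewrite PQ mem_irreds mem_monics => /and3P[_ _ /eqP].
by move: mQ; rewrite mem_monics => /andP[_ /eqP->] [->]; rewrite eqxx.
Qed.

End MonicPolynomials.

(** * Character sums over monic polynomials *)

Lemma sum_mul_eq_divisors (V : nmodType) (n : nat) (g : nat -> nat -> V) :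
  (0 < n)%N ->
  \sum_(1 <= i < n.+1) \sum_(1 <= k < n.+1) (if (i * k == n)%N then g i k else 0) =
  \sum_(i <- divisors n) g i (n %/ i)%N.
Proof.
move=> n0.
have inner i : i \in index_iota 1 n.+1 ->
    \sum_(1 <= k < n.+1) (if (i * k == n)%N then g i k else 0) =
    if (i %| n)%N then g i (n %/ i)%N else 0.
  rewrite mem_index_iota => /andP[i0 _].
  case: ifPn => [dvd_in|ndvd]; last first.
    apply: big1 => k _; case: eqP => // nE; move: ndvd.
    by rewrite -nE dvdn_mulr.
  rewrite (bigD1_seq (n %/ i)%N) ?iota_uniq //=; last first.
    by rewrite mem_index_iota divn_gt0 // dvdn_leq //= ltnS leq_div.
  rewrite mulnC divnK // eqxx big1 ?addr0 // => k nk; case: eqP => // nE.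
  by rewrite -nE mulKn // eqxx in nk.
rewrite (eq_big_seq _ inner) -big_mkcond -big_filter /=.
apply: perm_big; apply: uniq_perm; rewrite ?filter_uniq ?iota_uniq ?divisors_uniq //.
move=> i; rewrite mem_filter mem_index_iota -dvdn_divisors //.
by case: (boolP (i %| n)%N) => //= di; rewrite ltnS (dvdn_leq n0 di) (dvdn_gt0 n0 di).
Qed.

(** A predicate on plain functions, so that the constant [1], [fun x => chi (t * x)] and
    [fun x => chi (x *+ k)] are all covered. *)
Definition addchar (V : zmodType) (R : pzSemiRingType) (chi : V -> R) : Prop :=
  chi 0 = 1 /\ {morph chi : x y / x + y >-> x * y}.

Definition nontrivial_addchar (V : zmodType) (R : pzSemiRingType) (chi : V -> R) :
  Prop := addchar chi /\ exists x, chi x != 1.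

Lemma addchar1 (V : zmodType) (R : pzSemiRingType) :
  addchar (fun _ : V => 1 : R).
Proof. by split=> // x y; rewrite mulr1. Qed.

Lemma addcharMn (V : zmodType) (R : pzSemiRingType) (chi : V -> R) x k :
  addchar chi -> chi (x *+ k) = chi x ^+ k.
Proof.
case=> chi0 chiD; elim: k => [|k IH]; first by rewrite mulr0n chi0.
by rewrite mulrS chiD IH exprS.
Qed.

Section CharacterSums.

Variables (F : finFieldType) (R : idomainType) (chi : F -> R).
Hypothesis chi_char : addchar chi.

Let lam (f : {poly F}) : R := chi (sublead f).

Definition charsum (d : nat) : R := \sum_(f <- monics F d) lam f.

Lemma charsum0 : charsum 0 = 1.
Proof. by rewrite /charsum monics0 big_seq1 /lam sublead1 (proj1 chi_char). Qed.

Lemma addchar_subleadM a b (f g : {poly F}) :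
  f \in monics F a -> g \in monics F b -> lam (f * g) = lam f * lam g.
Proof. by move=> mf mg; rewrite /lam (subleadM mf mg) (proj2 chi_char). Qed.

(** The degree [n] of [f] is the sum of deg [P] over the prime powers [P ^+ k] dividing [f];
    exchange the sums and put [f = P ^+ k * g]. The free bound [N] lets the identities for different
    [n] share their index ranges. *)
Lemma charsum_von_mangoldt N n :
  (n <= N)%N ->
  n%:R * charsum n =
  \sum_(1 <= i < N.+1) \sum_(1 <= k < N.+1)
     if (i * k <= n)%N then
       (\sum_(P <- irreds F i) chi (sublead P *+ k)) * i%:R * charsum (n - i * k)
     else 0.
Proof.
move=> leN; rewrite /charsum mulr_sumr.
rewrite (eq_big_seq (fun f => \sum_(1 <= i < N.+1) \sum_(1 <= k < N.+1)
    \sum_(P <- irreds F i) (i * (P ^+ k %| f)%R)%:R * lam f)); last first.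
  move=> f mf; rewrite -[in LHS](sum_irred_powers mf leN) natr_sum mulr_suml.
  apply: eq_bigr => i _; rewrite exchange_big natr_sum mulr_suml /=.
  by apply: eq_bigr => k _; rewrite natr_sum mulr_suml.
rewrite exchange_big /=; apply: eq_bigr => i _.
rewrite exchange_big /=; apply: eq_bigr => k _.
rewrite exchange_big /=.
transitivity (\sum_(P <- irreds F i)
   if (i * k <= n)%N then chi (sublead P *+ k) * i%:R * charsum (n - i * k) else 0).
  apply: eq_big_seq => P; rewrite mem_irreds => /andP[_ mP].
  rewrite (eq_bigr (fun f => i%:R * if (P ^+ k %| f)%R then lam f else 0)); last first.
    by move=> f _; rewrite natrM -mulrA; case: ifP; rewrite (mul1r, mul0r).
  rewrite -mulr_sumr -(subleadX k mP).
  rewrite -big_mkcond /=.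
  under eq_bigl => f do rewrite -[(_ %| _)%R]andbT.
  rewrite (big_monics_dvdp _ (fun _ => true) _ (monicsX k mP)).
  case: ifP => _; last by rewrite mulr0.
  rewrite /charsum mulr_sumr mulr_sumr; apply: eq_big_seq => g mg.
  by rewrite (addchar_subleadM (monicsX k mP) mg) mulrCA mulrA.
case: ifP => _; last by rewrite big1.
by rewrite !mulr_suml.
Qed.

(** One irreducible at a time: among the survivors of [D], those divisible by [P] are the [P * g]
    with [g] again a survivor of [D], and the new factor subtracts them. *)
Lemma charsum_sieve N (D : seq {poly F}) d :
    uniq D -> {in D, forall P, exists i, P \in irreds F i} -> (d <= N)%N ->
  \sum_(f <- monics F d | all (fun P => ~~ (P %| f)) D) lam f =
  ((\prod_(P <- D) (1 - lam P *: 'X^((size P).-1))) *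
    \poly_(i < N.+1) charsum i)`_d.
Proof.
elim: D d => [|P D IH] d /=.
  by move=> _ _ led; rewrite big_nil mul1r coef_poly ltnS led.
case/andP=> PD uD irD led.
have [a irP] := irD P (mem_head _ _).
have irD' : {in D, forall Q, exists i, Q \in irreds F i}.
  by move=> Q QD; apply: irD; rewrite inE QD orbT.
have mP : P \in monics F a by move: irP; rewrite mem_irreds => /andP[].
have sP : (size P).-1 = a by move: mP; rewrite mem_monics => /andP[_ /eqP->].
rewrite big_cons sP -mulrA mulrBl mul1r coefB -scalerAl coefZ coefXnM.
rewrite -IH // [X in X - _](bigID (fun f => P %| f)) /=.
rewrite [X in X + _ - _](eq_bigl (fun f => (P %| f) && all (fun Q => ~~ (Q %| f)) D));
  last by move=> f; rewrite andbC.
rewrite (big_monics_dvdp _ _ _ mP) ltnNge.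
rewrite [X in _ + X - _](eq_bigl (fun f => ~~ (P %| f) && all (fun Q => ~~ (Q %| f)) D));
  last by move=> f; rewrite andbC.
case: leqP => [lead|_]; last by rewrite mulr0 subr0 add0r.
rewrite -IH //=; last exact: leq_trans (leq_subr _ _) led.
rewrite addrAC -[LHS]add0r; congr (_ + _); apply/esym/eqP.
rewrite subr_eq0 mulr_sumr; apply/eqP.
rewrite big_seq_cond [RHS]big_seq_cond; apply: eq_big => [g|g /andP[mg _]]; last first.
  by rewrite (addchar_subleadM mP mg).
congr (_ && _); apply: eq_in_all => Q QD.
have [b irQ] := irD' _ QD.
(* [Q] divides [P * g] exactly when it divides [g], as distinct monic irreducibles are coprime. *)
rewrite mulrC Gauss_dvdpl // (irreds_coprimep irQ irP) //.
by apply: contraNneq PD => <-.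
Qed.

End CharacterSums.

Section NontrivialCharacterSums.

Variables (F : finFieldType) (R : idomainType) (chi : F -> R).
Hypothesis chi_nontriv : nontrivial_addchar chi.

Lemma sum_addchar : \sum_x chi x = 0.
Proof.
have [[chi0 chiD] [a chia]] := chi_nontriv.
have : chi a * (\sum_x chi x) = \sum_x chi x.
  rewrite mulr_sumr [RHS](reindex (+%R a)) /=; last first.
    by exists (+%R (- a)) => x _; rewrite ?addKr ?addNKr.
  by apply: eq_bigr => x _; rewrite chiD.
move/eqP; rewrite -subr_eq0 -{2}[\sum_x chi x]mul1r -mulrBl mulf_eq0 subr_eq0.
by rewrite (negPf chia) => /eqP.
Qed.

(** In positive degree [d.+1], adding [a *: 'X^d] permutes the monics and multiplies the sum by
    [chi a], where [a] is chosen with [chi a != 1]. *)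
Lemma charsum_nontrivial d : charsum chi d = (d == 0%N)%:R.
Proof.
have [chi_char [a chia]] := chi_nontriv; have [chi0 chiD] := chi_char.
case: d => [|d]; first exact: charsum0.
pose h := (a *: 'X^d : {poly F}).
have sh : (size h <= d.+1)%N by rewrite (leq_trans (size_scale_leq _ _)) // size_polyXn.
have shift : perm_eq (monics F d.+1) [seq h + f | f <- monics F d.+1].
  apply: uniq_perm; first exact: monics_uniq.
    by rewrite map_inj_uniq ?monics_uniq //; apply: addrI.
  move=> f; apply/idP/mapP => [|[g]] /monicsP[r sr ->].
    exists ('X^(d.+1) + r - h); last by rewrite [RHS]addrC subrK.
    apply/monicsP; exists (r - h); last by rewrite addrA.
    by rewrite (leq_trans (size_polyD _ _)) // geq_max size_polyN sr sh.
  move=> ->; apply/monicsP; exists (h + r); last by rewrite addrCA.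
  by rewrite (leq_trans (size_polyD _ _)) // geq_max sr sh.
have : charsum chi d.+1 = chi a * charsum chi d.+1.
  rewrite {1}/charsum (perm_big _ shift) big_map /charsum mulr_sumr.
  apply: eq_big_seq => f mf; rewrite -chiD; congr chi.
  have mhf : h + f \in monics F d.+1 by rewrite (perm_mem shift) map_f.
  rewrite (monics_subleadE mf) (monics_subleadE mhf) -addrA mulrDr coefD.
  by rewrite !coefXM /= coefZ coefXn eqxx mulr1.
move/eqP; rewrite -subr_eq0 -{1}[charsum _ _]mul1r -mulrBl mulf_eq0 subr_eq0.
by rewrite eq_sym (negPf chia) => /eqP.
Qed.

(** Since [charsum] vanishes in positive degree, von Mangoldt's identity keeps only the terms with
    [i * k = n]. *)
Lemma sum_irreds_nontrivial n :
  (0 < n)%N ->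
  \sum_(i <- divisors n)
     i%:R * \sum_(P <- irreds F i) chi (sublead P *+ (n %/ i)) = 0.
Proof.
move=> n0; rewrite -(sum_mul_eq_divisors (fun i k =>
  i%:R * \sum_(P <- irreds F i) chi (sublead P *+ k))) //.
have := charsum_von_mangoldt (proj1 chi_nontriv) (leqnn n).
rewrite charsum_nontrivial eqn0Ngt n0 mulr0 => E; rewrite [RHS]E {E}.
apply: eq_bigr => i _; apply: eq_bigr => k _.
rewrite charsum_nontrivial subn_eq0.
case: ltngtP => //; first by rewrite mulr0.
by rewrite mulr1 mulrC.
Qed.

End NontrivialCharacterSums.

Lemma charsum_trivial (F : finFieldType) (R : idomainType) d :
  charsum (fun _ : F => 1 : R) d = (#|F| ^ d)%:R.
Proof. by rewrite /charsum big_const_seq count_predT iter_addr_0 size_monics. Qed.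

(** Gauss's formula, from the trivial character: subtracting $q$ times von Mangoldt's identity in
    one degree from the identity in the next cancels every term except those with [i * k] equal to
    the larger degree. *)
Lemma sum_card_irreds (F : finFieldType) n :
  (0 < n)%N -> (\sum_(i <- divisors n) i * size (irreds F i) = #|F| ^ n)%N.
Proof.
case: n => // n _; apply/eqP; rewrite -(eqr_nat rat) natr_sum; apply/eqP.
have H k := @charsum_von_mangoldt _ _ _ (addchar1 F rat) n.+1 k.
have H1 := H n.+1 (leqnn _); have H0 := H n (leqnSn _).
rewrite -(sum_mul_eq_divisors (fun i k => (i * size (irreds F i))%:R)) //.
rewrite !charsum_trivial in H0 H1.
have -> : (#|F| ^ n.+1)%:R =
    n.+1%:R * (#|F| ^ n.+1)%:R - #|F|%:R * (n%:R * (#|F| ^ n)%:R) :> rat.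
  by rewrite -natr1 expnS !natrM; ring.
rewrite H1 H0 mulr_sumr -sumrB; apply: eq_bigr => i _.
rewrite mulr_sumr -sumrB; apply: eq_bigr => k _.
rewrite big_const_seq count_predT iter_addr_0 !charsum_trivial.
case: (ltngtP (i * k) n.+1)%N => [lt|gt|->].
- by rewrite -ltnS lt subSn // expnS natrM; ring.
- by rewrite leqNgt (ltnW gt) mulr0 subr0.
- by rewrite ltnn subnn mulr0 subr0 mulr1 natrM mulrC.
Qed.

(** * Moebius inversion *)

Lemma mobius_primeMn r k :
  prime r -> (0 < k)%N -> mobius (r * k) = if (r %| k)%N then 0 else - mobius k.
Proof.
move=> pr k0; have r0 := prime_gt0 pr; rewrite /mobius; case: (boolP (r %| k)%N) => rk.
  case: ifP => // /allP all1; have := all1 r.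
  rewrite mem_primes pr muln_gt0 r0 k0 dvdn_mulr //= => /(_ isT) /eqP.
  rewrite lognM // logn_prime // eqxx => -[/eqP].
  by rewrite -leqn0 leqNgt logn_gt0 mem_primes pr k0 rk.
have rNk : r \notin primes k by rewrite mem_primes (negPf rk) !andbF.
have pE : perm_eq (primes (r * k)) (r :: primes k).
  apply: uniq_perm; rewrite /= ?rNk ?primes_uniq // => s.
  by rewrite primesM // primes_prime // !inE.
rewrite (perm_all _ pE) (perm_size pE) /= lognM // logn_prime // eqxx.
have -> : logn r k = 0%N by apply/eqP; rewrite -leqn0 leqNgt logn_gt0.
have -> : all (fun s => logn s (r * k) == 1%N) (primes k) =
          all (fun s => logn s k == 1%N) (primes k).
  apply: eq_in_all => s sk; rewrite lognM // logn_prime //.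
  by case: (eqVneq r s) => // rs; rewrite rs sk in rNk.
by rewrite /=; case: ifP => _; rewrite ?oppr0 // exprS mulN1r.
Qed.

(** With [r] the least prime factor of [n], a divisor [k] prime to [r] cancels against [r * k];
    multiples of the square of [r] contribute [0]. *)
Lemma sum_mobius n :
  (0 < n)%N -> \sum_(k <- divisors n) mobius k = (n == 1%N)%:R.
Proof.
move=> n0; have [->|n1] := eqVneq n 1%N; first by rewrite big_seq1.
have pr : prime (pdiv n) by rewrite pdiv_prime //; lia.
set r := pdiv n in pr; have rn : (r %| n)%N := pdiv_dvd n.
have r0 := prime_gt0 pr.
rewrite (bigID (fun k => r %| k)%N) /= -big_filter.
have pE : perm_eq [seq k <- divisors n | r %| k]%N
                  [seq (r * k)%N | k <- divisors (n %/ r)].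
  apply: uniq_perm; rewrite ?filter_uniq ?divisors_uniq //.
    by rewrite map_inj_uniq ?divisors_uniq // => a b /eqP; rewrite eqn_pmul2l // => /eqP.
  move=> k; rewrite mem_filter -dvdn_divisors //; apply/andP/mapP => [[rk kn]|[l]].
    exists (k %/ r)%N; last by rewrite mulnC divnK.
    rewrite -dvdn_divisors ?divn_gt0 ?(dvdn_leq n0) // dvdn_divRL //.
    by rewrite divnK.
  rewrite -dvdn_divisors ?divn_gt0 ?(dvdn_leq n0) // dvdn_divRL // => ln ->.
  by rewrite dvdn_mulr // mulnC.
rewrite (perm_big _ pE) big_map.
have nr0 : (0 < n %/ r)%N by rewrite divn_gt0 ?(dvdn_leq n0).
rewrite (eq_big_seq (fun k => if (~~ (r %| k))%N then - mobius k else 0)); last first.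
  move=> k; rewrite -dvdn_divisors // => /(dvdn_gt0 nr0) k0.
  by rewrite mobius_primeMn //; case: (r %| k)%N.
rewrite -big_mkcond sumrN /= addrC; apply/eqP; rewrite subr_eq0; apply/eqP.
rewrite -[LHS]big_filter -[RHS]big_filter; apply: perm_big.
apply: uniq_perm; rewrite ?filter_uniq ?divisors_uniq // => k.
rewrite !mem_filter -!dvdn_divisors // dvdn_divRL //.
case: (boolP (r %| k)%N) => //= rk.
by rewrite Gauss_dvd ?rn ?andbT // coprime_sym prime_coprime.
Qed.

Lemma big_divisors_div (V : nmodType) n k (C : pred nat) (f : nat -> V) :
  (0 < n)%N -> (k %| n)%N ->
  \sum_(i <- divisors (n %/ k) | C i) f i =
  \sum_(i <- divisors n | (k * i %| n)%N && C i) f i.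
Proof.
move=> n0 kn; have k0 := dvdn_gt0 n0 kn.
rewrite -big_filter_cond -[LHS]big_filter -[RHS]big_filter; apply: perm_big.
apply: uniq_perm; rewrite ?filter_uniq ?divisors_uniq // => i.
rewrite !mem_filter -!dvdn_divisors ?divn_gt0 ?(dvdn_leq n0) //.
rewrite dvdn_divRL // [(i * k)%N]mulnC; congr andb.
by apply/idP/andP => [kin|[]//]; rewrite kin (dvdn_trans _ kin) ?dvdn_mull.
Qed.

(* Taking [eps] completely multiplicative lets the inversion also treat sums
   restricted to cofactors prime to [p]. *)
Lemma mobius_inversion (R : pzRingType) (eps : pred nat) (y h : nat -> R) n :
    {morph eps : a b / (a * b)%N >-> a && b} ->
    (forall k, (0 < k)%N -> \sum_(i <- divisors k | eps (k %/ i)%N) y i = h k) ->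
    (0 < n)%N ->
  \sum_(k <- divisors n | eps k) (mobius k)%:~R * h (n %/ k)%N =
  if eps 1%N then y n else 0.
Proof.
move=> epsM yh n0.
rewrite big_seq_cond.
rewrite (eq_bigr (fun k => \sum_(i <- divisors n | (k * i %| n)%N && eps (n %/ k %/ i)%N)
    (mobius k)%:~R * y i)); last first.
  move=> k; rewrite -dvdn_divisors // => /andP[kn _].
  have nk0 : (0 < n %/ k)%N by rewrite divn_gt0 ?(dvdn_gt0 n0 kn) // dvdn_leq.
  by rewrite -(yh _ nk0) big_divisors_div // mulr_sumr.
rewrite -big_seq_cond (exchange_big_dep predT) //=.
rewrite (eq_big_seq (fun i => if i == n then if eps 1%N then y n else 0 else 0)).
  rewrite (bigD1_seq n) ?divisors_uniq -?dvdn_divisors //= eqxx.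
  by rewrite big1 ?addr0 // => i /negPf->.
move=> i; rewrite -dvdn_divisors // => i_n.
have i0 := dvdn_gt0 n0 i_n.
have ni0 : (0 < n %/ i)%N by rewrite divn_gt0 // dvdn_leq.
(* By multiplicativity [eps k] and [eps (n %/ k %/ i)] together say [eps (n %/ i)], which no longer
   involves [k]. *)
transitivity (\sum_(k <- divisors (n %/ i) | eps (n %/ i)%N) (mobius k)%:~R * y i).
  rewrite big_divisors_div // big_seq_cond [RHS]big_seq_cond.
  apply: eq_bigl => k; rewrite -dvdn_divisors // mulnC.
  apply: andb_id2l => kn; rewrite andbCA; apply: andb_id2l => ikn.
  by rewrite -divnMA mulnC divnMA -epsM mulnC divnK // dvdn_divRL // mulnC.
case: (boolP (eps _)) => epsn; last first.
  rewrite big_pred0_eq; case: eqP => // ni; case: ifP => //.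
  by move: epsn; rewrite ni divnn n0 => /negPf->.
rewrite -mulr_suml -rmorph_sum sum_mobius //.
have -> : (n %/ i == 1)%N = (i == n).
  by rewrite eq_sym eqn_div // mul1n.
case: eqP => [ni|]; last by rewrite mul0r.
by move: epsn; rewrite ni divnn n0 => ->; rewrite mul1r.
Qed.

(** * Irreducible polynomials with given subleading coefficient *)

Section AdditiveCharacters.

Variables (F : finFieldType) (R : idomainType) (chi : F -> R).

Lemma addchar_twist t :
  t != 0 -> nontrivial_addchar chi -> nontrivial_addchar (fun x => chi (t * x)).
Proof.
move=> t0 [[chi0 chiD] [a chia]]; split; first split.
- by rewrite mulr0.
- by move=> x y; rewrite mulrDr chiD.
- by exists (t^-1 * a); rewrite mulVKf.
Qed.

Lemma sum_addchar_twist x :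
  nontrivial_addchar chi -> \sum_t chi (t * x) = (#|F| * (x == 0))%:R.
Proof.
move=> chiN; have [->|x0] := eqVneq x 0.
  under eq_bigr do rewrite mulr0 (proj1 (proj1 chiN)).
  by rewrite sumr_const muln1.
rewrite muln0 mulr0n -[RHS](sum_addchar (addchar_twist x0 chiN)).
by apply: eq_bigr => t _; rewrite mulrC.
Qed.

(** When all nontrivial twists give the same sum [b], only [t = 0] stands apart: it gives [size s],
    and the values [chi (- (t * a))] over [t != 0] add up to $q\mathbf{1}[a=0]-1$. *)
Lemma addchar_orthogonality (T : Type) (s : seq T) (g : T -> F) (b : R) a :
    nontrivial_addchar chi ->
    (forall t, t != 0 -> \sum_(f <- s) chi (t * g f) = b) ->
  #|F|%:R * (count (fun f => g f == a) s)%:R =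
  (size s)%:R + (#|F|%:R * (a == 0)%:R - 1) * b.
Proof.
move=> chiN sb; have [[chi0 chiD] _] := chiN.
transitivity (\sum_t chi (- (t * a)) * \sum_(f <- s) chi (t * g f)).
  under [RHS]eq_bigr do rewrite mulr_sumr.
  rewrite exchange_big /= -sum1_count natr_sum mulr_sumr [LHS]big_mkcond /=.
  apply: eq_bigr => f _.
  rewrite [RHS](eq_bigr (fun t => chi (t * (g f - a)))); last first.
    by move=> t _; rewrite -chiD mulrBr addrC.
  by rewrite sum_addchar_twist // subr_eq0; case: eqP; rewrite ?(muln1, muln0, mulr1).
rewrite (bigD1 0) //= mul0r oppr0 chi0 mul1r; congr (_ + _).
  by under eq_bigr do rewrite mul0r chi0; rewrite big_const_seq count_predT iter_addr_0.
rewrite (eq_bigr (fun t => chi (t * - a) * b)); last first.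
  by move=> t t0; rewrite sb // mulrN.
rewrite -mulr_suml; congr (_ * _).
have := sum_addchar_twist (- a) chiN.
rewrite (bigD1 0) //= mul0r chi0 oppr_eq0 natrM => <-.
by rewrite [RHS]addrC addKr.
Qed.

End AdditiveCharacters.

(** * Counting irreducibles by subleading coefficient *)

Section IrreducibleCounts.

Variables (p : nat) (F : finFieldType).
Hypothesis pcharFp : p \in [pchar F].
Variable (C : numFieldType).

Lemma addchar_mulrn (chi : F -> C) k :
    ~~ (p %| k)%N -> nontrivial_addchar chi ->
  nontrivial_addchar (fun x => chi (x *+ k)).
Proof.
move=> pk chiN; have k0 : k%:R != 0 :> F by rewrite -(dvdn_pcharf pcharFp).
have [[h0 hD] [a ha]] := addchar_twist k0 chiN.
split; first split; rewrite ?mul0rn //.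
- by rewrite (proj1 (proj1 chiN)).
- by move=> x y; rewrite mulrnDl (proj2 (proj1 chiN)).
- by exists a; rewrite -mulr_natl.
Qed.

Lemma irreds_charsum_mulrn (chi : F -> C) i k :
    addchar chi -> (p %| k)%N ->
  \sum_(P <- irreds F i) chi (sublead P *+ k) = (size (irreds F i))%:R.
Proof.
move=> [chi0 _] pk; rewrite (eq_bigr (fun=> 1)) => [|P _].
  by rewrite big_const_seq count_predT iter_addr_0.
have := pk; rewrite (dvdn_pcharf pcharFp) => /eqP k0.
by rewrite -mulr_natl k0 mul0r chi0.
Qed.

(* The recursion [sum_irreds_nontrivial] does not see the character. *)
Lemma irreds_charsum_eq (chi chi' : F -> C) n :
    (0 < n)%N -> nontrivial_addchar chi -> nontrivial_addchar chi' ->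
  \sum_(P <- irreds F n) chi (sublead P) = \sum_(P <- irreds F n) chi' (sublead P).
Proof.
elim/ltn_ind: n => n IH in chi chi' *; move=> n0 chiN chiN'.
have := etrans (sum_irreds_nontrivial chiN' n0) (esym (sum_irreds_nontrivial chiN n0)).
rewrite !(bigD1_seq n) ?divisors_uniq -?dvdn_divisors //= divnn n0.
have -> : \sum_(i <- divisors n | i != n)
      i%:R * \sum_(P <- irreds F i) chi' (sublead P *+ (n %/ i)) =
    \sum_(i <- divisors n | i != n)
      i%:R * \sum_(P <- irreds F i) chi (sublead P *+ (n %/ i)).
  rewrite big_seq_cond [RHS]big_seq_cond; apply: eq_bigr => i.
  rewrite -dvdn_divisors // => /andP[i_n n_i]; congr (_ * _).
  (* If [p] divides [n %/ i], the [n %/ i]-th powers of both characters are trivial; otherwise they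
     are nontrivial and induction applies. *)
  have [pni|pni] := boolP (p %| n %/ i)%N.
    by rewrite !irreds_charsum_mulrn //; [case: chiN | case: chiN'].
  apply: (IH i _ (fun x => chi' (x *+ (n %/ i))) (fun x => chi (x *+ (n %/ i)))).
  - by rewrite ltn_neqAle n_i dvdn_leq.
  - exact: dvdn_gt0 i_n.
  - exact: addchar_mulrn.
  - exact: addchar_mulrn.
move/addIr/mulfI; rewrite pnatr_eq0 -lt0n => /(_ n0).
exact: esym.
Qed.

(** Subtracting [sum_irreds_nontrivial] from [sum_card_irreds] kills the terms whose cofactor is
    divisible by [p]. Inversion over cofactors prime to [p] yields count minus character sum;
    inversion over all cofactors yields the count. *)
Lemma irreds_mobius (chi : F -> C) n :
    (0 < n)%N -> nontrivial_addchar chi ->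
  (\sum_(P <- irreds F n) chi (sublead P) = ratr (bcoef p #|F| n)) *
  ((size (irreds F n))%:R = #|F|%:R * acoef p #|F| n + bcoef p #|F| n :> rat).
Proof.
move=> n0 chiN; set q := #|F|.
pose T i := \sum_(P <- irreds F i) chi (sublead P).
have q0 : (0 < q)%N by apply/card_gt0P; exists 0.
have nz : n%:R != 0 :> C by rewrite pnatr_eq0 -lt0n.
have full : \sum_(k <- divisors n) (mobius k)%:~R * (q ^ (n %/ k))%:R =
    (n * size (irreds F n))%:R :> C.
  apply: (@mobius_inversion _ predT (fun i => (i * size (irreds F i))%:R)
    (fun i => (q ^ i)%:R)) => // k k0.
  by rewrite -natr_sum sum_card_irreds.
have part : \sum_(k <- divisors n | ~~ (p %| k)%N) (mobius k)%:~R * (q ^ (n %/ k))%:R =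
    n%:R * ((size (irreds F n))%:R - T n) :> C.
  have p_prime := pcharf_prime pcharFp.
  have := @mobius_inversion C (fun k => ~~ (p %| k)%N)
    (fun i => i%:R * ((size (irreds F i))%:R - T i)) (fun i => (q ^ i)%:R) n.
  rewrite Euclid_dvd1 //; apply=> // [a b|k k0]; first by rewrite Euclid_dvdM // negb_or.
  rewrite -[RHS]subr0 -sum_card_irreds // natr_sum.
  rewrite -[X in _ - X](sum_irreds_nontrivial chiN k0).
  rewrite -sumrB [LHS]big_mkcond /=; apply: eq_big_seq => i; rewrite -dvdn_divisors // => ik.
  rewrite natrM -mulrBr; case: ifPn => pki.
    congr (_ * (_ - _)); apply: (irreds_charsum_eq (chi' := fun x => chi (x *+ (k %/ i)))) => //.
      exact: dvdn_gt0 ik.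
    exact: addchar_mulrn.
  by rewrite negbK in pki; rewrite irreds_charsum_mulrn ?subrr ?mulr0 //; case: chiN.
have ratr_sum (Q : pred nat) :
    ratr (\sum_(k <- divisors n | Q k) (mobius k)%:~R * (q ^ (n %/ k))%:R : rat) =
    \sum_(k <- divisors n | Q k) (mobius k)%:~R * (q ^ (n %/ k))%:R :> C.
  by rewrite rmorph_sum; apply: eq_bigr => k _; rewrite rmorphM /= ratr_int ratr_nat.
have TE : T n = ratr (bcoef p q n).
  rewrite /bcoef fmorph_div /= ratr_nat ratr_sum; apply: (mulfI nz).
  rewrite mulrC [RHS]mulrC divfK //.
  move: full; rewrite (bigID (fun k => p %| k)%N) /= part natrM.
  by move=> h; apply/(addIr (n%:R * ((size (irreds F n))%:R - T n))); rewrite h; ring.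
split=> //; apply: (fmorph_inj (@ratr C)).
rewrite rmorphD rmorphM /= !ratr_nat -TE /acoef fmorph_div /= ratr_nat ratr_sum part.
have qz : q%:R != 0 :> C by rewrite pnatr_eq0 -lt0n.
by rewrite natrM; field; rewrite qz nz.
Qed.

(** Orthogonality with common twisted sum $b_n$; the identity is proved in [C] and pulled back along
    the injective [ratr]. *)
Lemma count_irreds_sublead (chi : F -> C) n c :
    (0 < n)%N -> nontrivial_addchar chi ->
  (count (fun P => sublead P == c) (irreds F n))%:R =
  acoef p #|F| n + (c == 0)%:R * bcoef p #|F| n :> rat.
Proof.
move=> n0 chiN; have [TE sE] := irreds_mobius n0 chiN.
have q0 : (0 < #|F|)%N by apply/card_gt0P; exists 0.
have qz : #|F|%:R != 0 :> rat by rewrite pnatr_eq0 -lt0n.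
have := @addchar_orthogonality _ _ _ _ (irreds F n) (@sublead F) _ c chiN.
move=> /(_ (ratr (bcoef p #|F| n))) H.
apply: (mulfI qz); apply: (fmorph_inj (@ratr C)).
have := congr1 (@ratr C) sE; rewrite rmorphD rmorphM /= !ratr_nat => sE'.
rewrite !rmorphM rmorphD rmorphM /= !ratr_nat H ?sE'; first by ring.
move=> t t0; rewrite -TE.
exact: (irreds_charsum_eq n0 (addchar_twist t0 chiN) chiN).
Qed.

End IrreducibleCounts.

(** * Generalized binomial series *)

(** Each factor is [- z ^+ i] times a linear factor of ['X^n - 1] at a power of [z^-1]; evaluation
    at [0] shows that the constants multiply to [-1]. *)
Lemma prod_1_sub_prim_root (K : fieldType) (z : K) n :
  n.-primitive_root z -> \prod_(i < n) (1 - z ^+ i *: 'X) = 1 - 'X^n :> {poly K}.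
Proof.
move=> zP; have n0 := prim_order_gt0 zP.
have z0 : z != 0 by rewrite (prim_root_eq0 zP) -lt0n.
have zVP : n.-primitive_root z^-1.
  have := zP; rewrite /primitive_root_of_unity => /andP[-> /=] /forallP zi.
  apply/forallP => i; rewrite -(eqP (zi i)).
  by rewrite !unity_rootE exprVn invr_eq1.
pose w := \prod_(i < n) (- z ^+ i).
have key : \prod_(i < n) (1 - z ^+ i *: 'X) = w *: ('X^n - 1).
  rewrite -(factor_Xn_sub_1 zVP) big_mkord /w -scaler_prod.
  apply: eq_bigr => i _; rewrite scalerBr addrC scaleNr; congr (_ + _).
  by rewrite -mul_polyC -polyCM mulNr exprVn divff ?expf_neq0 // polyCN opprK.
have := congr1 (fun f => f.[0]) key.
rewrite horner_prod big1 => [|i _]; last by rewrite !hornerE ?mulr0 ?subr0.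
rewrite !hornerE /= ?hornerXn expr0n gtn_eqF //= sub0r mulrN1 => w1.
by rewrite key -[w]opprK -w1 scaleN1r opprB.
Qed.

(** [chi] takes each [p]-th root of unity equally often, $q/p$ times: translations by multiples of
    [a], with [chi a != 1], carry the fibres to one another. *)
Lemma prod_addchar (F : finFieldType) (p : nat) (K : fieldType) (chi : F -> K) :
    p \in [pchar F] -> nontrivial_addchar chi ->
  \prod_c (1 - chi c *: 'X) = (1 - 'X^p) ^+ (#|F| %/ p) :> {poly K}.
Proof.
move=> pcharFp chiN; have [chiC [a chia]] := chiN; have [chi0 chiD] := chiC.
have p_prime := pcharf_prime pcharFp; have p0 := prime_gt0 p_prime.
have chip c : chi c ^+ p = 1 by rewrite -addcharMn // mulrn_pchar.
pose z := chi a.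
have zP : p.-primitive_root z.
  have [d zd dp] := prim_order_exists p0 (chip a).
  have [_ /(_ _ dp) /pred2P[d1|<- //]] := primeP p_prime.
  by move: zd; rewrite d1 => /prim_expr_order /eqP; rewrite (negPf chia).
pose h c := sval (prim_rootP zP (chip c)).
have hE c : chi c = z ^+ h c by rewrite /h; case: prim_rootP.
pose N k := #|[pred c | h c == k]|.
pose k0 := Ordinal p0.
have NE k : N k = N k0.
  rewrite /N -!sum1_card (reindex (+%R (a *+ k))) /=; last first.
    by exists (+%R (- (a *+ k))) => x _; rewrite ?addKr ?addNKr.
  apply: eq_bigl => c; rewrite !inE.
  have hP (x : F) (j : 'I_p) : (h x == j) = (chi x == z ^+ j).
    by rewrite hE (eq_prim_root_expr zP) !modn_small.
  rewrite !hP chiD addcharMn // -[X in _ == X]mulr1 expr0 -/z.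
  by rewrite (inj_eq (mulfI _)) // expf_neq0 // (prim_root_eq0 zP) -lt0n.
have cardF : (N k0 * p = #|F|)%N.
  rewrite -sum1_card (partition_big h predT) //=.
  under eq_bigr => k _ do rewrite sum1_card -/(N k) NE.
  by rewrite sum_nat_const card_ord mulnC.
rewrite (partition_big h predT) //= -cardF mulnK //.
rewrite -(prod_1_sub_prim_root zP) -prodrXl; apply: eq_bigr => k _.
rewrite (eq_bigr (fun=> 1 - z ^+ k *: 'X)) => [|c /eqP <-]; last by rewrite hE.
by rewrite prodr_const -(NE k).
Qed.

(** * Polynomials modulo a power of ['X], in place of power series *)

Section TruncatedPolynomials.

Variable R : comNzRingType.
Implicit Types f g : {poly R}.

Definition eq_upto (K : nat) f g : Prop := forall k, (k < K)%N -> f`_k = g`_k.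

Lemma eq_upto_mul K f f' g g' :
  eq_upto K f f' -> eq_upto K g g' -> eq_upto K (f * g) (f' * g').
Proof.
move=> ff gg k kK; rewrite !coefM; apply: eq_bigr => i _.
by rewrite ff ?gg // (leq_ltn_trans _ kK) // ?leq_subr // -ltnS.
Qed.

Lemma eq_upto_prod K (I : Type) (r : seq I) (f g : I -> {poly R}) :
  (forall i, eq_upto K (f i) (g i)) ->
  eq_upto K (\prod_(i <- r) f i) (\prod_(i <- r) g i).
Proof.
move=> fg; elim: r => [|i r IH]; first by rewrite !big_nil.
by rewrite !big_cons; apply: eq_upto_mul.
Qed.

Lemma coef_1_subX_mul f k :
  ((1 - 'X) * f)`_k = f`_k - (if k is k'.+1 then f`_k' else 0).
Proof. by rewrite mulrBl mul1r coefB coefXM; case: k. Qed.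

(** [1 - 'X] is a unit modulo ['X^K]. *)
Lemma eq_upto_1_subX_inj K N f g :
  eq_upto K ((1 - 'X) ^+ N * f) ((1 - 'X) ^+ N * g) -> eq_upto K f g.
Proof.
elim: N f g => [|N IH] f g; first by rewrite !mul1r.
rewrite exprSr -!mulrA => /IH fg k; elim: k => [|k IHk] kK.
  by have := fg 0%N kK; rewrite !coef_1_subX_mul !subr0.
by have := fg k.+1 kK; rewrite !coef_1_subX_mul IHk ?(ltnW kK) // => /addIr.
Qed.

End TruncatedPolynomials.

Lemma gbinom0 b : gbinom b 0 = 1.
Proof. by rewrite /gbinom big_ord0 divr1. Qed.

Lemma gbinomS b k : gbinom b k.+1 = gbinom b k * (b - k%:R) / k.+1%:R.
Proof.
rewrite /gbinom big_ord_recr /= factS natrM.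
have h1 : k`!%:R != 0 :> rat by rewrite pnatr_eq0 -lt0n fact_gt0.
have h2 : 1 + k%:R != 0 :> rat by rewrite nat1r pnatr_eq0.
by move: (\prod__ _) => x; field; rewrite h1 h2.
Qed.

Lemma gbinom_pascal b k : gbinom (b + 1) k.+1 = gbinom b k.+1 + gbinom b k.
Proof.
elim: k => [|k IH]; first by rewrite !gbinomS !gbinom0; field.
rewrite gbinomS IH [in RHS]gbinomS.
have h1 : 1 + k%:R != 0 :> rat by rewrite nat1r pnatr_eq0.
have h2 : 2 + k%:R != 0 :> rat by rewrite -natrD pnatr_eq0.
by rewrite !gbinomS; move: (gbinom b k) => x; field; rewrite h1 h2.
Qed.

Lemma gbinom_nat n k : gbinom n%:R k = 'C(n, k)%:R.
Proof.
elim: n k => [|n IH] [|k]; rewrite ?gbinom0 ?bin0 //.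
  rewrite bin0n /=; elim: k => [|k IH]; rewrite gbinomS.
    by rewrite subr0 mulr0 mul0r.
  by rewrite IH !mul0r.
by rewrite -natr1 gbinom_pascal !IH binS natrD.
Qed.

(** The series $(1-X)^b$ truncated below degree [K]. *)
Definition gbinomial_poly (K : nat) (b : rat) : {poly rat} :=
  \poly_(j < K) (gbinom b j * (-1) ^+ j).

Lemma gbinomial_polyD1 K b :
  eq_upto K ((1 - 'X) * gbinomial_poly K b) (gbinomial_poly K (b + 1)).
Proof.
move=> [|k] kK; rewrite coef_1_subX_mul !coef_poly kK; first by rewrite subr0 !gbinom0.
by rewrite (ltnW kK) gbinom_pascal exprS; ring.
Qed.

Lemma gbinomial_polyD K N b :
  eq_upto K ((1 - 'X) ^+ N * gbinomial_poly K b) (gbinomial_poly K (b + N%:R)).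
Proof.
elim: N => [|N IH] k kK; first by rewrite mul1r addr0.
rewrite -natr1 addrA -gbinomial_polyD1 // exprS -mulrA.
exact: (eq_upto_mul (fun _ _ => erefl) IH kK).
Qed.

Lemma gbinomial_poly_nat K n : eq_upto K (gbinomial_poly K n%:R) ((1 - 'X) ^+ n).
Proof.
move=> k kK; rewrite -[n%:R]add0r -gbinomial_polyD //.
rewrite -[in RHS](mulr1 (_ ^+ n)); apply: (@eq_upto_mul _ K) => // {k kK} k kK.
rewrite coef_poly kK (gbinom_nat 0) bin0n coef1.
by case: k kK => [|k] _; rewrite ?mulr1 ?mul0r.
Qed.

(** The clause for [b = 0] is a value of the general sum: [gbinom 0 (k - p * j)] vanishes unless
    [p * j = k]. *)
Lemma AcoefE p q k a b :
  (0 < p)%N ->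
  Acoef p q k a b = \sum_(j < (k %/ p).+1)
      gbinom (a * q%:R / p%:R) j * gbinom b (k - p * j) * (-1) ^+ (j + p * j).
Proof.
move=> p0; rewrite /Acoef; case: eqP => // ->.
have g0 n : gbinom 0 n = (n == 0%N)%:R.
  by rewrite (gbinom_nat 0) bin0n.
case: ifPn => [pk|pk].
  rewrite big_ord_recr /= big1 ?add0r => [|j _]; rewrite g0 mulnC ?divnK //.
    by rewrite subnn mulr1 addnC.
  rewrite gtn_eqF ?mulr0 ?mul0r // subn_gt0.
  by rewrite -ltn_divRL.
rewrite big1 // => j _; rewrite g0 gtn_eqF ?mulr0 ?mul0r // subn_gt0 mulnC.
rewrite ltn_neqAle -leq_divRL // -ltnS ltn_ord andbT.
by apply: contraNneq pk => <-; apply: dvdn_mull.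
Qed.

Lemma coef_1_subXn_exp_mul (R : comNzRingType) p M (f : {poly R}) k :
  (0 < p)%N ->
  ((1 - 'X^p) ^+ M * f)`_k =
  \sum_(j < (k %/ p).+1) 'C(M, j)%:R * (-1) ^+ j * f`_(k - p * j).
Proof.
move=> p0.
have -> : (1 - 'X^p) ^+ M =
    \sum_(j < M.+1) ('C(M, j)%:R * (-1) ^+ j) *: 'X^(p * j) :> {poly R}.
  rewrite exprDn; apply: eq_bigr => j _.
  by rewrite expr1n mul1r -[- 'X^p]scaleN1r exprZn -exprM -scaler_nat scalerA.
rewrite mulr_suml coef_sum.
under eq_bigr do rewrite -scalerAl coefZ coefXnM.
(* A common bound for the two ranges of [j]; terms with [j > M] vanish with the binomial. *)
pose N := (M.+1 + (k %/ p).+1)%N.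
pose c j : R := 'C(M, j)%:R * (-1) ^+ j * f`_(k - p * j).
transitivity (\sum_(0 <= j < N | (p * j <= k)%N && (j < M.+1)%N) c j).
  rewrite -(big_mkord predT (fun j => 'C(M, j)%:R * (-1) ^+ j *
     (if (k < p * j)%N then 0 else f`_(k - p * j)))).
  rewrite (big_nat_widen _ _ N) ?leq_addr // big_mkcondl big_mkcond [RHS]big_mkcond.
  apply: eq_bigr => j _ /=; rewrite /c.
  by case: ltnP => // jM; case: leqP => //; rewrite mulr0.
rewrite -(big_mkord predT c) [RHS](big_nat_widen _ _ N) ?leq_addl //.
rewrite big_mkcond [RHS]big_mkcond; apply: eq_bigr => j _ /=.
rewrite [(j < (k %/ p).+1)%N]ltnS leq_divRL // mulnC; case: (leqP (j * p) k) => _ //=.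
by case: (ltnP j M.+1) => //= Mj; rewrite /c bin_small // !mul0r.
Qed.

(** ['X] stands for $u^i$; [smooth_monics_nontrivial] restores the exponent by composition. *)
Lemma prod_irreds_character (F : finFieldType) p (C : numFieldType) (chi : F -> C) i k :
    p \in [pchar F] -> (p %| #|F|)%N -> nontrivial_addchar chi -> (0 < i)%N ->
  (\prod_(P <- irreds F i) (1 - chi (sublead P) *: 'X))`_k =
  ratr (Acoef p #|F| k (acoef p #|F| i) (bcoef p #|F| i) * (-1) ^+ k).
Proof.
move=> pcharFp pF chiN i0; set q := #|F|; set a := acoef _ _ _; set b := bcoef _ _ _.
have p0 := prime_gt0 (pcharf_prime pcharFp).
(* [N c] is $a$ for $c\ne0$ and $a+b$ for $c=0$, so both are natural numbers whatever the sign of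
   [b]. *)
pose N c := count (fun P => sublead P == c) (irreds F i).
have NE c : (N c)%:R = a + (c == 0)%:R * b := count_irreds_sublead pcharFp c i0 chiN.
have aE : a = (N 1)%:R by rewrite NE oner_eq0 mul0r addr0.
have N0 : b + (N 1)%:R = (N 0)%:R by rewrite -aE NE eqxx mul1r addrC.
have N1 c : c != 0 -> N c = N 1.
  by move=> c0; apply/eqP; rewrite -(eqr_nat rat) !NE oner_eq0 (negPf c0).
pose M := (q %/ p * N 1%R)%N.
have ME : a * q%:R / p%:R = M%:R.
  have pz : p%:R != 0 :> rat by rewrite pnatr_eq0 -lt0n.
  by rewrite /M natrM aE -{1}(divnK pF : (q %/ p * p = q)%N) natrM; field.
set G := \prod_(P <- _) _.
have GE : G = (1 - 'X) ^+ N 0 * \prod_(c | c != 0) (1 - chi c *: 'X) ^+ N 1.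
  have -> : G = \prod_c (1 - chi c *: 'X) ^+ N c.
    rewrite /G (partition_big (@sublead F) predT) //=; apply: eq_bigr => c _.
    rewrite (eq_bigr (fun=> 1 - chi c *: 'X)) => [|P /eqP-> //].
    by rewrite big_const_seq iter_mulr_1.
  rewrite (bigD1 0) //= (proj1 (proj1 chiN)) scale1r; congr (_ * _).
  by apply: eq_bigr => c /N1->.
(* The extra factors [1 - 'X] complete the product to all [c], which [prod_addchar] evaluates. *)
have GE' : (1 - 'X) ^+ N 1 * G = (1 - 'X) ^+ N 0 * (1 - 'X^p) ^+ M.
  rewrite GE mulrCA; congr (_ * _).
  rewrite /M exprM -(prod_addchar pcharFp chiN) -prodrXl [RHS](bigD1 0) //=.
  by rewrite (proj1 (proj1 chiN)) scale1r.
(* Multiplication by [(1 - 'X) ^+ N 1] turns the exponent [b] into the natural number [N 0], so a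
   negative [b] calls for no division. *)
have {GE'} : eq_upto k.+1 G
    (map_poly (@ratr C) ((1 - 'X^p) ^+ M * gbinomial_poly k.+1 b)).
  apply: (@eq_upto_1_subX_inj _ _ (N 1)) => j jk; rewrite GE'.
  have ratr1X n m : map_poly (@ratr C) ((1 - 'X^n) ^+ m) = (1 - 'X^n) ^+ m.
    by rewrite rmorphXn rmorphB rmorph1 /= map_polyXn.
  have ratrX m : map_poly (@ratr C) ((1 - 'X) ^+ m) = (1 - 'X) ^+ m := ratr1X 1%N m.
  rewrite -!ratrX -ratr1X -!rmorphM !coef_map /=.
  congr ratr.
  rewrite mulrCA mulrC; apply: (@eq_upto_mul _ k.+1) => // l lk.
  by rewrite gbinomial_polyD // N0 gbinomial_poly_nat.
move/(_ k (ltnSn k)) ->; rewrite coef_map /=; congr ratr.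
rewrite coef_1_subXn_exp_mul // AcoefE // mulr_suml; apply: eq_bigr => j _.
rewrite ME gbinom_nat coef_poly ltnS leq_subr.
move: (gbinom b _) => g; rewrite -!mulrA; congr (_ * _).
rewrite mulrCA; congr (_ * _); rewrite -!exprD -signr_odd -[RHS]signr_odd.
(* The signs agree because [k - p * j], an exact subtraction, has the parity of [k + p * j]. *)
congr (_ ^+ nat_of_bool _).
have jk : (p * j <= k)%N by rewrite mulnC -leq_divRL // -ltnS.
by rewrite !oddD oddB //; case: (odd j) (odd k) (odd (p * j)) => [] [] [].
Qed.

(** * Sieving smooth polynomials *)

(** Distributivity when the range of the inner sum depends on [i]: [bigA_distr_big_dep] wants one
    type of choices, so they are tagged with their index. *)
Lemma prod_sum_dffun (R : comNzRingType) (I : finType) (T_ : I -> finType)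
    (P_ : forall i, T_ i -> R) :
  \prod_i \sum_(j : T_ i) P_ i j =
  \sum_(t : {dffun forall i : I, T_ i}) \prod_i P_ i (t i).
Proof.
pose Q i := [ffun j => P_ i j].
transitivity (\prod_i \sum_(j in tagged_with T_ i) untag 0 (Q i) j).
  apply: eq_bigr => i _; rewrite -(big_tag (fun i => Q i)).
  by apply: eq_bigr => j _; rewrite ffunE.
rewrite bigA_distr_big_dep -big_fprod (reindex (@dffun_of_fprod _ T_)) /=; last first.
  exact/onW_bij/dffun_of_fprod_bij.
by apply: eq_bigr => t _; apply: eq_bigr => i _; rewrite !ffunE.
Qed.

(** As [w i > 0], coefficients of [f i] beyond index [m] cannot reach degree [d], so each factor is
    truncated before expanding. *)
Lemma coef_prod_comp_polyXn (R : comNzRingType) (I : finType) (w : I -> nat)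
    (f : I -> {poly R}) m d :
    (forall i, 0 < w i)%N -> (d <= m)%N ->
  (\prod_i (f i \Po 'X^(w i)))`_d =
  \sum_(k : {ffun I -> 'I_m.+1} | (\sum_i w i * k i)%N == d) \prod_i (f i)`_(k i).
Proof.
move=> w0 dm.
have trunc i : eq_upto m.+1 (f i \Po 'X^(w i))
                            (\sum_(k < m.+1) (f i)`_k *: 'X^(w i * k)).
  move=> j jm; rewrite coef_comp_poly_Xn // coef_sum.
  under eq_bigr do rewrite coefZ coefXn.
  case: ifPn => [wj|wj].
    have lt : (j %/ w i < m.+1)%N by apply: leq_ltn_trans jm; apply: leq_div.
    rewrite (bigD1 (Ordinal lt)) //= mulnC divnK // eqxx mulr1 big1 ?addr0 // => k.
    rewrite -val_eqE /= => kj; case: eqP => [jE|_]; last by rewrite mulr0.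
    by rewrite jE mulKn ?eqxx in kj.
  rewrite big1 // => k _; case: eqP => [jE|_]; last by rewrite mulr0.
  by rewrite jE dvdn_mulr in wj.
rewrite (eq_upto_prod _ trunc) // bigA_distr_bigA coef_sum [RHS]big_mkcond.
apply: eq_bigr => k _; rewrite scaler_prod prodrXr coefZ coefXn eq_sym.
by case: eqP; rewrite ?mulr1 ?mulr0.
Qed.

Lemma irreducible_polyZ (K : fieldType) (c : K) (d : {poly K}) :
  c != 0 -> irreducible_poly d -> irreducible_poly (c *: d).
Proof.
move=> c0 [sd irrd]; split; first by rewrite size_scale.
move=> g sg; rewrite dvdpZr // => /(irrd _ sg) gd.
by rewrite (eqp_trans gd) // eqp_sym eqp_scale.
Qed.

Section SmoothPolynomials.

Variables (F : finFieldType) (m n : nat).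

(** Degrees [n + 1] to [n + r]: [r = m - n] covers all that can divide a polynomial of degree [m],
    and a free [r] permits induction. *)
Definition large_irreds (r : nat) : seq {poly F} :=
  flatten [seq irreds F (n.+1 + i) | i <- iota 0 r].

Lemma large_irredsP r P :
  reflect (exists2 i, (i < r)%N & P \in irreds F (n.+1 + i)) (P \in large_irreds r).
Proof.
apply: (iffP flattenP) => [[s /mapP[i]]|[i ir irP]].
  by rewrite mem_iota => ir -> irP; exists i.
by exists (irreds F (n.+1 + i)) => //; apply: map_f; rewrite mem_iota.
Qed.

Lemma large_irreds_uniq r : uniq (large_irreds r).
Proof.
elim: r => // r IH; rewrite /large_irreds -(addn1 r) iotaD map_cat flatten_cat /= cats0.
rewrite cat_uniq IH irreds_uniq andbT /=; apply/hasPn => P; rewrite add0n => irP.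
apply/negP => /large_irredsP[i ir]; move: irP.
rewrite !mem_irreds !mem_monics => /and3P[_ _ /eqP->] /and3P[_ _].
by rewrite eqSS eqn_add2l gtn_eqF.
Qed.

Definition smooth_monics : seq {poly F} :=
  [seq f <- monics F m | all (fun P => ~~ (P %| f)) (large_irreds (m - n))].

Lemma smooth_monicsP f :
  f \in monics F m -> smooth n f <-> f \in smooth_monics.
Proof.
move=> mf; rewrite mem_filter mf andbT; split=> [sf|/allP sf d ird df].
  apply/allP => P /large_irredsP[i _]; rewrite mem_irreds mem_monics.
  move=> /and3P[/irreducibleP irP _ /eqP sP]; apply/negP => Pf.
  by have := sf P irP Pf; rewrite sP; lia.
rewrite leqNgt; apply/negP => nd.
have d0 := irredp_neq0 ird.
have ld0 : lead_coef d != 0 by rewrite lead_coef_eq0.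
have mfE : size f = m.+1 by move: mf; rewrite mem_monics => /andP[_ /eqP].
have f0 : f != 0 by rewrite -size_poly_eq0 mfE.
have sd : (size d <= m.+1)%N by rewrite -mfE dvdp_leq.
have sd1 : (1 < size d)%N := ird.1.
(* [smooth] speaks of all irreducibles, [large_irreds] only of monic ones, so [d] is normalised. *)
suff /sf : (lead_coef d)^-1 *: d \in large_irreds (m - n).
  by rewrite dvdpZl ?invr_eq0 // df.
apply/large_irredsP; exists ((size d).-1 - n.+1)%N; first by lia.
rewrite mem_irreds mem_monics monicE lead_coefZ mulVf // eqxx.
rewrite size_scale ?invr_eq0 //= subnKC // (prednK (ltnW sd1)) eqxx !andbT.
by apply/irreducibleP; apply: irreducible_polyZ; rewrite ?invr_eq0.
Qed.

Lemma smooth_monics_charsum (R : idomainType) (chi : F -> R) :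
  addchar chi ->
  \sum_(f <- smooth_monics) chi (sublead f) =
  ((\prod_(i < m - n) \prod_(P <- irreds F (n.+1 + i))
      (1 - chi (sublead P) *: 'X^(n.+1 + i))) *
    \poly_(d < m.+1) charsum chi d)`_m.
Proof.
move=> chiC; rewrite big_filter (charsum_sieve chiC (large_irreds_uniq _) _ (leqnn m)).
  congr ((_ * _ : {poly R})`_m); rewrite big_flatten big_map /=.
  rewrite -(big_mkord predT (fun i => \prod_(P <- irreds F (n.+1 + i))
      (1 - chi (sublead P) *: 'X^(n.+1 + i)))) /index_iota subn0.
  apply: eq_bigr => i _; apply: eq_big_seq => P.
  by rewrite mem_irreds mem_monics => /and3P[_ _ /eqP->].
by move=> P /large_irredsP[i _ irP]; exists (n.+1 + i)%N.
Qed.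

(** The last factor is $1/(1-qu)$ truncated, so a monomial of degree $s\le m$ from the sieve
    contributes $q^{m-s}$, and one with $s>m$ nothing. *)
Lemma size_smooth_monics :
  (size smooth_monics)%:R =
  (#|F| ^ m)%:R *
    (\sum_(j : {dffun forall i : 'I_(m - n), 'I_(#|monic_irr F (n.+1 + i)|).+1}
            | (\sum_(i < m - n) (n.+1 + i) * j i <= m)%N)
       \prod_(i < m - n)
          (#|F|%:R ^- ((n.+1 + i) * j i)
           * 'C(#|monic_irr F (n.+1 + i)|, j i)%:R * (-1) ^+ j i)) :> rat.
Proof.
have q0 : #|F|%:R != 0 :> rat.
  by rewrite pnatr_eq0 -lt0n; apply/card_gt0P; exists 0.
have := smooth_monics_charsum (addchar1 F rat).
rewrite big_const_seq count_predT iter_addr_0 => ->.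
pose c (i : 'I_(m - n)) (j : 'I_(#|monic_irr F (n.+1 + i)|).+1) : rat :=
  (-1) ^+ j * 'C(#|monic_irr F (n.+1 + i)|, j)%:R.
rewrite (eq_bigr (fun i : 'I_(m - n) =>
  \sum_(j < (#|monic_irr F (n.+1 + i)|).+1) c i j *: 'X^((n.+1 + i) * j))); last first.
  move=> i _; rewrite big_const_seq count_predT iter_mulr_1 scale1r size_irreds.
  rewrite exprDn; apply: eq_bigr => j _.
  by rewrite expr1n mul1r -scaleN1r exprZn -exprM -scaler_nat scalerA mulrC.
rewrite prod_sum_dffun mulr_suml coef_sum mulr_sumr [RHS]big_mkcond.
apply: eq_bigr => j _; rewrite scaler_prod prodrXr -scalerAl coefZ coefXnM.
case: leqP => [le|_]; last by rewrite mulr0.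
rewrite coef_poly ltnS leq_subr charsum_trivial.
have qm : #|F|%:R ^+ m = #|F|%:R ^+ (m - \sum_(i < m - n) (n.+1 + i) * j i) *
    #|F|%:R ^+ (\sum_(i < m - n) (n.+1 + i) * j i) :> rat by rewrite -exprD subnK.
rewrite !natrX qm -mulrA mulrC; congr (_ * _).
rewrite -prodrXr -big_split /=; apply: eq_bigr => i _.
by rewrite /c -mulrA mulVKf ?expf_neq0 // mulrC.
Qed.

(** The value does not depend on [chi], as [addchar_orthogonality] requires. *)
Lemma smooth_monics_nontrivial p (C : numFieldType) (chi : F -> C) :
    p \in [pchar F] -> (p %| #|F|)%N -> nontrivial_addchar chi ->
  \sum_(f <- smooth_monics) chi (sublead f) =
  ratr (\sum_(k : {ffun 'I_(m - n) -> 'I_m.+1}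
            | (\sum_(i < m - n) (n.+1 + i) * k i)%N == m)
       \prod_(i < m - n)
          (Acoef p #|F| (k i) (acoef p #|F| (n.+1 + i)) (bcoef p #|F| (n.+1 + i))
           * (-1) ^+ k i)).
Proof.
move=> pcharFp pF chiN; rewrite smooth_monics_charsum; last by case: chiN.
have -> : \poly_(d < m.+1) charsum chi d = 1.
  apply/polyP => d; rewrite coef_poly coef1 charsum_nontrivial //.
  by case: d => [|d] /=; rewrite ?if_same.
rewrite mulr1 (eq_bigr (fun i : 'I_(m - n) =>
  (\prod_(P <- irreds F (n.+1 + i)) (1 - chi (sublead P) *: 'X)) \Po 'X^(n.+1 + i))).
  rewrite (@coef_prod_comp_polyXn _ _ (fun i => n.+1 + val i)%N _ m) //.
  rewrite rmorph_sum; apply: eq_bigr => k _; rewrite rmorph_prod.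
  by apply: eq_bigr => i _; rewrite (@prod_irreds_character _ p).
move=> i _; rewrite rmorph_prod; apply: eq_bigr => P _.
by rewrite /= comp_polyB comp_polyC comp_polyZ comp_polyX.
Qed.

Lemma card_smooth_prescribed alpha :
  (0 < m)%N ->
  #|smooth_prescribed m n alpha| = count (fun f => sublead f == alpha) smooth_monics.
Proof.
move=> m0.
have -> : #|smooth_prescribed m n alpha| = size
    (map (fun f : {poly_m.+1 F} => (f : {poly F})) (enum (smooth_prescribed m n alpha))).
  by rewrite size_map -cardE.
rewrite -size_filter; apply/perm_size/uniq_perm.
- by rewrite map_inj_uniq ?enum_uniq //; exact: val_inj.
- by rewrite !filter_uniq ?monics_uniq.
have subE (r : {poly F}) : (size r <= m)%N -> sublead ('X^m + r) = r`_m.-1.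
  move=> sr; rewrite (@monics_subleadE _ m); last by apply/monicsP; exists r.
  by rewrite addrAC subrr add0r coefXM gtn_eqF.
move=> f; rewrite mem_filter; apply/mapP/andP => [[g]|[/eqP fa fS]].
  rewrite mem_enum inE => /and3P[_ /asboolP sg /existsP[h /eqP gE]] ->.
  have sr : (size (alpha *: 'X^(m.-1) + h : {poly F})%R <= m)%N.
    apply: leq_trans (size_polyD _ _) _; rewrite geq_max.
    rewrite (leq_trans (size_scale_leq _ _)) ?size_polyXn ?prednK //=.
    by rewrite (leq_trans (size_npoly h)) ?leq_pred.
  have mg : (g : {poly F}) \in monics F m.
    by rewrite gE -addrA; apply/monicsP; exists (alpha *: 'X^(m.-1) + h).
  split; last exact/(smooth_monicsP mg).
  rewrite gE -addrA subE // coefD coefZ coefXn eqxx mulr1.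
  by rewrite [X in _ + X]nth_default ?size_npoly // addr0.
have mf : f \in monics F m by move: fS; rewrite mem_filter => /andP[].
have sf : size f = m.+1 by move: mf; rewrite mem_monics => /andP[_ /eqP].
have [r sr fE] := monicsP _ _ mf.
exists (npolyp m.+1 f); last by rewrite npolypK ?sf.
rewrite mem_enum inE npolypK ?sf //; apply/and3P; split.
- by move: mf; rewrite mem_monics => /andP[].
- by apply/asboolP/smooth_monicsP.
(* The top coefficient of [r] is [alpha], so removing it leaves size at most [m.-1]. *)
apply/existsP; exists (npolyp m.-1 (r - alpha *: 'X^(m.-1))).
rewrite npolypK ?[X in X == _]fE -?addrA; first by rewrite [_ + (r - _)]addrC subrK.
apply/leq_sizeP => j; rewrite leq_eqVlt coefB coefZ coefXn => /predU1P[<-|lj].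
  by rewrite eqxx mulr1 -(subE r sr) -fE fa subrr.
by rewrite nth_default ?gtn_eqF ?mulr0 ?subr0 // (leq_trans sr) // -(prednK m0).
Qed.

End SmoothPolynomials.

(** The additive group is abelian with more than one element, so its irreducible character of index
    [1] is linear and not principal. *)
Lemma nontrivial_addchar_exists (F : finFieldType) :
  exists chi : F -> algC, nontrivial_addchar chi.
Proof.
pose G := [set: F]%G.
have cardG : (1 < Nirr G)%N.
  rewrite NirrE classes_gt1; apply/trivgPn; exists 1; rewrite ?inE //.
  exact: oner_neq0.
pose i : Iirr G := Ordinal cardG.
have lin : 'chi_i \is a linear_char.
  by apply/char_abelianP; exact: FinRing.zmod_abelian.
exists 'chi_i; split; first split.
- exact: (lin_char1 lin).
- by move=> x y; rewrite -FinRing.zmodMgE lin_charM ?inE.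
apply: contrapT => triv.
have /eqP : 'chi_i = 1.
  apply/cfunP => x; rewrite cfun1E inE; apply: contrapT => chix.
  by apply: triv; exists x; apply/eqP.
by rewrite irr_eq1.
Qed.

(* An index i : 'I_(m - n) stands for the degree n + 1 + i, so the degrees run
   over n + 1, ..., m.  In the second sum the bound k_i <= m loses nothing,
   since the k_i satisfy \sum_i (n + 1 + i) * k_i = m. *)
Theorem corollary17 (p e q : nat) (F : finFieldType)
    (p_prime : prime p) (e_gt0 : (0 < e)%N) (def_q : q = (p ^ e)%N)
    (card_F : #|F| = q)
    (m n : nat) (m_gt0 : (0 < m)%N) (n_gt0 : (0 < n)%N) (alpha : F) :
  #|smooth_prescribed m n alpha|%:R =
    (q ^ (m - 1))%:R *
      (\sum_(j : {dffun forall i : 'I_(m - n), 'I_(#|monic_irr F (n.+1 + i)|).+1}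
              | (\sum_(i < m - n) (n.+1 + i) * j i <= m)%N)
         \prod_(i < m - n)
            (q%:R ^- ((n.+1 + i) * j i)
             * 'C(#|monic_irr F (n.+1 + i)|, j i)%:R * (-1) ^+ j i))
    + (q%:R * (alpha == 0)%:R - 1) / q%:R *
      (\sum_(k : {ffun 'I_(m - n) -> 'I_m.+1}
              | (\sum_(i < m - n) (n.+1 + i) * k i)%N == m)
         \prod_(i < m - n)
            (Acoef p q (k i) (acoef p q (n.+1 + i)) (bcoef p q (n.+1 + i))
             * (-1) ^+ k i))
  :> rat.
Proof.
have pcharFp : p \in [pchar F] by apply: (@card_finPcharP _ p e); rewrite // card_F.
have pF : (p %| #|F|)%N by rewrite card_F def_q dvdn_exp.
have [chi chiN] := nontrivial_addchar_exists F.
have q0 : q%:R != 0 :> rat.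
  by rewrite pnatr_eq0 -lt0n -card_F; apply/card_gt0P; exists 0.
have := @addchar_orthogonality _ _ _ _ (smooth_monics F m n) (@sublead F) _ alpha chiN.
move=> /(_ _ (fun t t0 =>
  smooth_monics_nontrivial m n pcharFp pF (addchar_twist t0 chiN))).
rewrite -card_smooth_prescribed // card_F; set B := \sum_(k | _) _ => H.
(* Both sides are rational, so the identity descends from [algC]. *)
have {}H : q%:R * #|smooth_prescribed m n alpha|%:R =
    (size (smooth_monics F m n))%:R + (q%:R * (alpha == 0)%:R - 1) * B :> rat.
  apply: (fmorph_inj (@ratr algC)).
  by rewrite rmorphD !rmorphM rmorphB rmorphM rmorph1 /= !ratr_nat.
apply: (mulfI q0); rewrite H size_smooth_monics card_F mulrDr mulrA.
have -> : q%:R * (q ^ (m - 1))%:R = (q ^ m)%:R :> rat.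
  by rewrite -natrM -expnS subn1 prednK.
by congr (_ + _); field.
Qed.
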